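(* Let $G$ be a topological group and $R$ a commutative ring. Then the $G$-equivariant zero-divisor cup length $\mathbf{zcl}_G(-)=\mathbf{zcl}_G(-;R)$ and the equivariant topological complexity $\mathbf{TC}_G$, regarded as maps $$\mathbf{zcl}_G,\ \mathbf{TC}_G\colon \mathrm{Ob}(\mathrm{Top}^G)\sqcup \mathrm{Mor}(\mathrm{Top}^G)\to \mathbb{N}\cup\{\infty\},$$ are $G$-categorical invariants.
   Context: $\mathrm{Top}^G$ is the category of topological spaces with $G$-action and $G$-equivariant maps ($G$-maps). $\mathbb N$ includes $0$. Products $X\times X$ carry the diagonal action; $Y^I$ is the space of paths $[0,1]\to Y$ with the pointwise action. $G$-categorical invariant: a map $\mathbf I^G$ assigning to each object and each morphism of $\mathrm{Top}^G$ a value in a totally ordered set of values (here $\mathbb N\cup\{\infty\}$) such that (1) $\mathbf I^G(\mathrm{id}_X)=\mathbf I^G(X)$ for every object $X$; (2) for all composable $G$-maps $X\xrightarrow{f}Y\xrightarrow{g}Z\xrightarrow{h}W$ one has $\mathbf I^G(h\circ g\circ f)\le \mathbf I^G(g)$. $\mathbf{TC}_G(f)$ for a $G$-map $f\colon X\to Y$ is the smallest $n\ge0$ such that $X\times X$ has a cover by $G$-invariant open sets $U_0,\dots,U_n$ with $G$-maps $s_i\colon U_i\to Y^I$ satisfying $s_i(x_0,x_1)(0)=f(x_0)$ and $s_i(x_0,x_1)(1)=f(x_1)$ ($\infty$ if no such $n$). $\mathbf{TC}_G(X)$ is the smallest $n\ge0$ such that $X\times X$ is covered by $n+1$ $G$-invariant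 open sets on each of which the path fibration $X^I\to X\times X$, $\gamma\mapsto(\gamma(0),\gamma(1))$, admits a $G$-equivariant section ($\infty$ if no such $n$). Borel cohomology: $X_G^h:=EG\times_G X$, $H_G^*(X;R):=H^*(X_G^h;R)$; a $G$-map $f$ induces $f_G^{h*}$ on $H_G^*(-;R)$. For a subset $S$ of a cohomology ring, $\mathrm{nil}(S)$ is the largest $k\ge 0$ such that some product of $k$ elements of $S$ is non-zero ($\infty$ if there is no largest such $k$; $0$ if all elements of $S$ are zero). With $\Delta_X\colon X\to X\times X$ the diagonal, $\mathbf{zcl}_G(X;R):=\mathrm{nil}(\ker (\Delta_X)_G^{h*})$ and, for a $G$-map $f\colon X\to Y$, $\mathbf{zcl}_G(f;R):=\mathrm{nil}\big((f\times f)_G^{h*}(\ker(\Delta_Y)_G^{h*})\big)$. *)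

(* Defs.v *)
From HB Require Import structures.
From mathcomp Require Import all_boot all_order all_algebra ring_quotient.
From mathcomp Require Import ring zify.
From mathcomp Require Import all_classical all_reals topology normedtype.

Set Implicit Arguments.
Unset Strict Implicit.
Unset Printing Implicit Defensive.

Import Order.TTheory GRing.Theory Num.Theory.
Import numFieldNormedType.Exports.

Local Open Scope classical_set_scope.
Local Open Scope ring_scope.
Local Open Scope quotient_scope.

Section Simplex.
Variable K : realType.

Definition simplex_set (n : nat) : set 'rV[K]_n.+1 :=
  [set t | (forall i, 0 <= t ord0 i) /\ \sum_i t ord0 i = 1].

Definition simplex (n : nat) : topologicalType := set_type (@simplex_set n).

(* The affine extension of a map of vertices, in barycentric coordinates *)
Definition push_row p n (phi : 'I_p.+1 -> 'I_n.+1) (t : 'rV[K]_p.+1) :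
    'rV[K]_n.+1 :=
  \row_j \sum_(i | phi i == j) t ord0 i.

Lemma push_row_simplex p n (phi : 'I_p.+1 -> 'I_n.+1) (t : simplex p) :
  push_row phi (set_val t) \in @simplex_set n.
Proof.
have [t0 t1] := set_mem (valP t); apply/mem_set; split=> [i|].
  by rewrite mxE sumr_ge0// => j _; exact: t0.
under eq_bigr do rewrite mxE.
by rewrite -t1 [RHS](partition_big phi predT).
Qed.

Definition simplex_map p n (phi : 'I_p.+1 -> 'I_n.+1) (t : simplex p) :
    simplex n :=
  exist _ (push_row phi (set_val t)) (push_row_simplex phi t).

Lemma push_row_continuous p n (phi : 'I_p.+1 -> 'I_n.+1) :
  continuous (push_row phi).
Proof.
move=> t A [P]; rewrite /= => Pt sPA.
have cc i j : continuous (fun s : 'rV[K]_p.+1 => push_row phi s i j).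
  have -> : (fun s : 'rV[K]_p.+1 => push_row phi s i j) =
            (fun s : 'rV[K]_p.+1 => \sum_(k | phi k == j) s ord0 k).
    by apply/funext => s; rewrite mxE.
  apply: (@continuous_big K 'I_p.+1 +%R 0 (fun k => phi k == j) _ _ _
    (fun k (s : 'rV[K]_p.+1) => s ord0 k)) => [|k _]; last exact: coord_continuous.
  by move=> x; exact: add_continuous.
have Pn : \forall s \near t, forall i j, P i j (push_row phi s i j).
  apply: (@filter_forall _ _ (fun i s => forall j, P i j (push_row phi s i j))
    _ (nbhs_filter t)) => i.
  apply: (@filter_forall _ _ (fun j s => P i j (push_row phi s i j))
    _ (nbhs_filter t)) => j.
  exact: (cc i j t (P i j) (Pt i j)).
by apply: filterS Pn => s; exact: sPA.
Qed.

Lemma simplex_map_continuous p n (phi : 'I_p.+1 -> 'I_n.+1) :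
  continuous (simplex_map phi).
Proof.
apply: continuous_comp_initial => t.
apply: (@continuous_comp _ _ _ set_val (push_row phi)).
  exact: initial_continuous.
exact: push_row_continuous.
Qed.

HB.instance Definition _ p n (phi : 'I_p.+1 -> 'I_n.+1) :=
  @isContinuous.Build (simplex p) (simplex n) (simplex_map phi)
    (@simplex_map_continuous p n phi).

Lemma simplex_map_id n : simplex_map (@id 'I_n.+1) =1 id.
Proof.
move=> t; apply: val_inj; apply/rowP => j; rewrite /= mxE.
by rewrite (eq_bigl (pred1 j)) ?big_pred1_eq.
Qed.

Lemma simplex_map_comp m p n (psi : 'I_m.+1 -> 'I_p.+1)
    (phi : 'I_p.+1 -> 'I_n.+1) :
  simplex_map phi \o simplex_map psi =1 simplex_map (phi \o psi).
Proof.
move=> t; apply: val_inj; apply/rowP => j; rewrite /= !mxE.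
under eq_bigr do rewrite mxE.
rewrite (partition_big psi (fun i => phi i == j)) //=.
apply: eq_bigr => i /eqP ij; apply: eq_bigl => k.
by case: (eqVneq (psi k) i) => [->|]; rewrite ?ij ?eqxx ?andbT ?andbF.
Qed.

End Simplex.

(* The coboundary and the cup product for functions on finite words, where the
   word v_0 ... v_n stands for the simplex with these vertices. *)
Section WordAlgebra.
Variables (T : Type) (R : comPzRingType).
Implicit Types (F G H : seq T -> R) (s : seq T) (x : T).

Definition wdiff F s : R :=
  \sum_(i < size s) (-1) ^+ i * F (take i s ++ drop i.+1 s).

Definition wcup F G s : R :=
  \sum_(i < size s) F (take i.+1 s) * G (drop i s).

Definition wsign F s : R := (-1) ^+ (size s).+1 * F s.

Lemma wdiff_nil F : wdiff F [::] = 0. Proof. exact: big_ord0. Qed.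

Lemma wdiff_cons F x s : wdiff F (x :: s) = F s - wdiff (F \o cons x) s.
Proof.
rewrite /wdiff big_ord_recl /= expr0 mul1r drop0; congr (_ + _).
by rewrite -sumrN; apply: eq_bigr => i _; rewrite /= exprS mulN1r mulNr.
Qed.

Lemma wcup_nil F G : wcup F G [::] = 0. Proof. exact: big_ord0. Qed.

Lemma wcup_cons F G x s :
  wcup F G (x :: s) = F [:: x] * G (x :: s) + wcup (F \o cons x) G s.
Proof. by rewrite /wcup big_ord_recl /= take0. Qed.

Lemma eq_wdiff F F' : F =1 F' -> wdiff F =1 wdiff F'.
Proof. by move=> e s; apply: eq_bigr => i _; rewrite e. Qed.

Lemma eq_wcupl F F' : F =1 F' -> forall G s, wcup F G s = wcup F' G s.
Proof. by move=> e G s; apply: eq_bigr => i _; rewrite e. Qed.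

Lemma eq_wcupr G G' : G =1 G' -> forall F s, wcup F G s = wcup F G' s.
Proof. by move=> e F s; apply: eq_bigr => i _; rewrite e. Qed.

Lemma wdiffD F F' s : wdiff (fun t => F t + F' t) s = wdiff F s + wdiff F' s.
Proof.
by rewrite /wdiff -big_split; apply: eq_bigr => i _; rewrite mulrDr.
Qed.

Lemma wdiffZ a F s : wdiff (fun t => a * F t) s = a * wdiff F s.
Proof.
by rewrite /wdiff big_distrr; apply: eq_bigr => i _; rewrite /= mulrCA.
Qed.

Lemma wdiffN F s : wdiff (fun t => - F t) s = - wdiff F s.
Proof. by rewrite /wdiff -sumrN; apply: eq_bigr => i _; rewrite mulrN. Qed.

Lemma wcupDl F F' G s :
  wcup (fun t => F t + F' t) G s = wcup F G s + wcup F' G s.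
Proof.
by rewrite /wcup -big_split; apply: eq_bigr => i _; rewrite mulrDl.
Qed.

Lemma wcupDr F G G' s :
  wcup F (fun t => G t + G' t) s = wcup F G s + wcup F G' s.
Proof.
by rewrite /wcup -big_split; apply: eq_bigr => i _; rewrite mulrDr.
Qed.

Lemma wcupZl a F G s : wcup (fun t => a * F t) G s = a * wcup F G s.
Proof.
by rewrite /wcup big_distrr; apply: eq_bigr => i _; rewrite /= mulrA.
Qed.

Lemma wcupNl F G s : wcup (fun t => - F t) G s = - wcup F G s.
Proof. by rewrite /wcup -sumrN; apply: eq_bigr => i _; rewrite mulNr. Qed.

Lemma wdiff_wdiff F s : wdiff (wdiff F) s = 0.
Proof.
elim: s F => [|x s IHs] F; first exact: wdiff_nil.
rewrite wdiff_cons.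
have /eq_wdiff -> : wdiff F \o cons x =1
    fun t => F t + - wdiff (F \o cons x) t by move=> t; exact: wdiff_cons.
by rewrite wdiffD wdiffN IHs oppr0 addr0 subrr.
Qed.

Lemma wcupA F G H s : wcup F (wcup G H) s = wcup (wcup F G) H s.
Proof.
elim: s F G => [|x s IHs] F G; first by rewrite !wcup_nil.
rewrite !wcup_cons wcup_nil addr0 mulrDr mulrA -addrA; congr (_ + _).
have /eq_wcupl -> : wcup F G \o cons x =1
    fun t => F [:: x] * (G \o cons x) t + wcup (F \o cons x) G t.
  by move=> t; exact: wcup_cons.
by rewrite wcupDl wcupZl IHs.
Qed.

Lemma wcup_diff F G s : G [::] = 0 ->
  wdiff (wcup F G) s =
  wcup (wdiff F) G s + wcup (wsign F) (wdiff G) s - F [::] * G s.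
Proof.
move=> G0; elim: s F => [|x s IHs] F.
  by rewrite wdiff_nil !wcup_nil G0 mulr0 subr0 addr0.
rewrite wdiff_cons !wcup_cons !wdiff_cons wdiff_nil subr0 /=.
have /eq_wdiff -> : wcup F G \o cons x =1
    fun t => F [:: x] * (G \o cons x) t + wcup (F \o cons x) G t.
  by move=> t; exact: wcup_cons.
have /eq_wcupl -> : wdiff F \o cons x =1
    fun t => F t + - wdiff (F \o cons x) t by move=> t; exact: wdiff_cons.
have /eq_wcupl -> : wsign F \o cons x =1 fun t => - wsign (F \o cons x) t.
  by move=> t; rewrite /wsign /= [in LHS]exprS mulN1r mulNr.
rewrite wdiffD wdiffZ IHs /= !wcupDl !wcupNl /wsign /= sqrrN expr1n mul1r.
rewrite mulrBr; move: (wcup _ _ _) (wcup _ _ _) (wcup _ _ _) => a b c.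
by ring.
Qed.

End WordAlgebra.

Section Cochains.
Variables (K : realType) (R : comPzRingType) (X : topologicalType).

Definition singular_simplex (n : nat) := continuousType (simplex K n) X.

Definition face p n (phi : 'I_p.+1 -> 'I_n.+1) (sigma : singular_simplex n) :
    singular_simplex p :=
  sigma \o simplex_map phi.

Lemma face_id n (sigma : singular_simplex n) : face id sigma = sigma.
Proof. by apply/continuousEP => t; rewrite /= simplex_map_id. Qed.

Lemma face_comp m p n (psi : 'I_m.+1 -> 'I_p.+1) (phi : 'I_p.+1 -> 'I_n.+1)
    (sigma : singular_simplex n) :
  face psi (face phi sigma) = face (phi \o psi) sigma.
Proof.
by apply/continuousEP => t; rewrite /= -(simplex_map_comp psi phi).
Qed.

(* The elements of the direct sum over [n] of the singular cochain groups
   C^n(X; R): all degrees at once, almost all components zero. *)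
Record cochain := Cochain {
  cochain_val :> forall n, singular_simplex n -> R;
  cochain_bounded : exists N, forall n (sigma : singular_simplex n),
    (N <= n)%N -> cochain_val sigma = 0
}.

Lemma cochainP (a b : cochain) :
  (forall n (sigma : singular_simplex n), a n sigma = b n sigma) -> a = b.
Proof.
case: a b => [a ha] [b hb] /= ab.
have {}ab : a = b.
  by apply: functional_extensionality_dep => n; apply/funext => s; exact: ab.
by rewrite {}ab in ha *; congr Cochain; exact: Prop_irrelevance.
Qed.

HB.instance Definition _ := gen_eqMixin cochain.
HB.instance Definition _ := gen_choiceMixin cochain.

Lemma cochain0_bounded : exists N, forall n (sigma : singular_simplex n),
  (N <= n)%N -> (0 : R) = 0.
Proof. by exists 0%N. Qed.
Definition cochain0 : cochain := Cochain cochain0_bounded.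

Lemma cochainN_bounded (a : cochain) : exists N,
  forall n (sigma : singular_simplex n), (N <= n)%N -> - a n sigma = 0.
Proof.
by have [N aN] := cochain_bounded a; exists N => n s /aN ->; rewrite oppr0.
Qed.
Definition cochainN (a : cochain) : cochain := Cochain (cochainN_bounded a).

Lemma cochainD_bounded (a b : cochain) : exists N,
  forall n (sigma : singular_simplex n), (N <= n)%N ->
    a n sigma + b n sigma = 0.
Proof.
have [N aN] := cochain_bounded a; have [M bM] := cochain_bounded b.
exists (maxn N M) => n s; rewrite geq_max => /andP[Nn Mn].
by rewrite aN// bM// addr0.
Qed.
Definition cochainD (a b : cochain) : cochain := Cochain (cochainD_bounded a b).

Lemma cochainDA : associative cochainD.
Proof. by move=> a b c; apply: cochainP => n s; exact: addrA. Qed.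
Lemma cochainDC : commutative cochainD.
Proof. by move=> a b; apply: cochainP => n s; exact: addrC. Qed.
Lemma cochain0D : left_id cochain0 cochainD.
Proof. by move=> a; apply: cochainP => n s; exact: add0r. Qed.
Lemma cochainND : left_inverse cochain0 cochainN cochainD.
Proof. by move=> a; apply: cochainP => n s; exact: addNr. Qed.

HB.instance Definition _ :=
  GRing.isZmodule.Build cochain cochainDA cochainDC cochain0D cochainND.

(* No sign convention enters: (d a)(s) is the alternating sum of [a] over the
   faces of [s], [lift i] being the i-th coface map. *)
Definition codiff_val (a : cochain) n : singular_simplex n -> R :=
  match n with
  | 0 => fun=> 0
  | m.+1 => fun sigma =>
      \sum_(i < m.+2) (-1) ^+ i * a m (face (lift i) sigma)
  end.

Lemma codiff_bounded (a : cochain) : exists N,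
  forall n (sigma : singular_simplex n), (N <= n)%N -> codiff_val a sigma = 0.
Proof.
have [N aN] := cochain_bounded a; exists N.+1 => -[//|n] s Nn.
by rewrite /= big1// => i _; rewrite aN ?mulr0.
Qed.
Definition codiff (a : cochain) : cochain := Cochain (codiff_bounded a).

(* Alexander-Whitney formula: the front face v_0 ... v_p times the back face
   v_p ... v_n *)
Definition front_vertices n p (i : 'I_p.+1) : 'I_n.+1 := inord i.
Definition back_vertices n p (i : 'I_(n - p).+1) : 'I_n.+1 := inord (p + i).

Definition cup_val (a b : cochain) n (sigma : singular_simplex n) : R :=
  \sum_(p < n.+1) a p (face (@front_vertices n p) sigma) *
                  b (n - p)%N (face (@back_vertices n p) sigma).

Lemma cup_bounded (a b : cochain) : exists N,
  forall n (sigma : singular_simplex n), (N <= n)%N -> cup_val a b sigma = 0.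
Proof.
have [N aN] := cochain_bounded a; have [M bM] := cochain_bounded b.
exists (N + M)%N => n s NMn; rewrite /cup_val big1// => p _.
have [Np|pN] := leqP N p; first by rewrite aN// mul0r.
by rewrite bM ?mulr0//; lia.
Qed.
Definition cup (a b : cochain) : cochain := Cochain (cup_bounded a b).

Definition cochain1_val n : singular_simplex n -> R := fun=> (n == 0)%:R.

Lemma cochain1_bounded : exists N,
  forall n (sigma : singular_simplex n), (N <= n)%N -> cochain1_val sigma = 0.
Proof. by exists 1%N => -[]. Qed.
Definition cochain1 : cochain := Cochain cochain1_bounded.

(* [eval_word a sigma s] is the value of [a] on the face of [sigma] spanned by
   the list of vertices [s], of dimension [(size s).-1]. It turns the identities
   below into identities about functions on lists, free of dependent degrees. *)
Definition eval_word (a : cochain) n (sigma : singular_simplex n) (s : seq 'I_n.+1) : R :=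
  if s is x :: s' then
    a (size s') (face (fun i : 'I_(size s').+1 => nth x s i) sigma)
  else 0.

Lemma eval_wordE (a : cochain) n (sigma : singular_simplex n) x0 s m
    (phi : 'I_m.+1 -> 'I_n.+1) :
  size s = m.+1 -> (forall i : 'I_m.+1, phi i = nth x0 s i) ->
  eval_word a sigma s = a m (face phi sigma).
Proof.
case: s => [//|x s] /= [sm]; case: _ / sm phi => phi /funext e.
have -> // : phi = fun i : 'I_(size s).+1 => nth x (x :: s) i.
by rewrite e; apply/funext => i; exact: set_nth_default.
Qed.

Lemma eval_word_enum (a : cochain) n (sigma : singular_simplex n) :
  eval_word a sigma (enum 'I_n.+1) = a n sigma.
Proof.
rewrite (@eval_wordE a n sigma ord0 _ n id) ?face_id ?size_enum_ord// => i.
by rewrite nth_ord_enum.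
Qed.

Lemma eval_word_inj (a b : cochain) :
  (forall n (sigma : singular_simplex n) s, eval_word a sigma s = eval_word b sigma s) -> a = b.
Proof. by move=> ab; apply: cochainP => n s; rewrite -!eval_word_enum ab. Qed.

Lemma eval_wordD (a b : cochain) n (sigma : singular_simplex n) s :
  eval_word (a + b) sigma s = eval_word a sigma s + eval_word b sigma s.
Proof. by case: s => [|x s] /=; rewrite ?addr0. Qed.

Lemma eval_word_codiff (a : cochain) n (sigma : singular_simplex n) s :
  eval_word (codiff a) sigma s = wdiff (eval_word a sigma) s.
Proof.
case: s => [|x [|y s]] /=; first by rewrite wdiff_nil.
  by rewrite wdiff_cons wdiff_nil subr0.
rewrite /wdiff; apply: eq_bigr => i _; congr (_ * _).
rewrite face_comp; apply/esym/(@eval_wordE _ _ _ x).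
  rewrite size_cat size_take size_drop; have := ltn_ord i; rewrite /=; case: ifP; lia.
move=> j /=; rewrite -[LHS]/(nth x [:: x, y & s] (bump i j)) nth_cat size_take.
rewrite ltn_ord nth_drop /bump; case: ltnP => ij.
  by rewrite nth_take// add0n.
by rewrite subnKC// add1n.
Qed.

Lemma eval_word_cup (a b : cochain) n (sigma : singular_simplex n) s :
  eval_word (cup a b) sigma s = wcup (eval_word a sigma) (eval_word b sigma) s.
Proof.
case: s => [|x s]; first by rewrite wcup_nil.
rewrite [LHS]/= /cup_val; apply: eq_bigr => p _; rewrite !face_comp.
have ps := ltn_ord p.
congr (_ * _); apply/esym.
- apply: (@eval_wordE _ _ _ x).
    by rewrite /= size_take; case: ltnP; lia.
  move=> i /=; have is_ := ltn_ord i.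
  rewrite /front_vertices inordK; last by lia.
  rewrite -[x :: take p s]/(take p.+1 (x :: s)) nth_take//.
- apply: (@eval_wordE _ _ _ x).
    by rewrite size_drop /=; lia.
  move=> i /=; have is_ := ltn_ord i.
  by rewrite /back_vertices inordK ?nth_drop//; lia.
Qed.

Lemma eval_word1 n (sigma : singular_simplex n) s :
  eval_word cochain1 sigma s = (size s == 1)%N%:R.
Proof. by case: s. Qed.

Lemma cupA : associative cup.
Proof.
move=> a b c; apply: eval_word_inj => n s t; rewrite !eval_word_cup.
rewrite (eq_wcupr (eval_word_cup b c s)) (eq_wcupl (eval_word_cup a b s)).
exact: wcupA.
Qed.

Lemma cup1a : left_id cochain1 cup.
Proof.
move=> a; apply: eval_word_inj => n s [|x t]; rewrite eval_word_cup ?wcup_nil//.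
rewrite wcup_cons eval_word1 mul1r /wcup big1 ?addr0// => i _.
rewrite [(eval_word _ _ \o _) _]eval_word1; case: t i => [|y t] [i it]//=.
by rewrite mul0r.
Qed.

Lemma cupa1 : right_id cochain1 cup.
Proof.
move=> a; apply: eval_word_inj => n s t; rewrite eval_word_cup.
elim/last_ind: t => [|t x _]; first by rewrite wcup_nil.
rewrite /wcup size_rcons big_ord_recr /= big1 ?add0r => [|i _].
  rewrite take_oversize ?size_rcons// eval_word1 size_drop size_rcons subSnn.
  by rewrite mulr1.
rewrite eval_word1 size_drop size_rcons; case: i => i /= it.
by rewrite (_ : _ == _ = false) ?mulr0//; lia.
Qed.

Lemma cupDl : left_distributive cup +%R.
Proof.
move=> a b c; apply: eval_word_inj => n s t; rewrite !(eval_wordD, eval_word_cup).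
by rewrite (eq_wcupl (eval_wordD a b s)) wcupDl.
Qed.

Lemma cupDr : right_distributive cup +%R.
Proof.
move=> a b c; apply: eval_word_inj => n s t; rewrite !(eval_wordD, eval_word_cup).
by rewrite (eq_wcupr (eval_wordD b c s)) wcupDr.
Qed.

HB.instance Definition _ :=
  GRing.Zmodule_isPzRing.Build cochain cupA cup1a cupa1 cupDl cupDr.

Lemma codiffB : {morph codiff : a b / a - b}.
Proof.
move=> a b; apply: cochainP => -[|n] s /=; first by rewrite oppr0 addr0.
by rewrite -sumrB; apply: eq_bigr => i _; rewrite mulrBr.
Qed.

Lemma codiff_codiff a : codiff (codiff a) = 0.
Proof.
apply: eval_word_inj => n s t; rewrite eval_word_codiff (eq_wdiff (eval_word_codiff a s)) wdiff_wdiff.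
by case: t.
Qed.

Lemma sign_bounded (a : cochain) : exists N,
  forall n (sigma : singular_simplex n), (N <= n)%N ->
    (-1) ^+ n * a n sigma = 0.
Proof.
by have [N aN] := cochain_bounded a; exists N => n s /aN ->; rewrite mulr0.
Qed.
Definition cochain_sign (a : cochain) : cochain := Cochain (sign_bounded a).

Lemma eval_word_sign (a : cochain) n (sigma : singular_simplex n) s :
  eval_word (cochain_sign a) sigma s = wsign (eval_word a sigma) s.
Proof.
case: s => [|x s]; first by rewrite /wsign mulr0.
by rewrite /wsign !exprS !mulN1r opprK.
Qed.

Lemma cochain_signK : involutive cochain_sign.
Proof. by move=> a; apply: cochainP => n s /=; rewrite mulrA -expr2 sqrr_sign mul1r. Qed.

Lemma codiff_sign a : codiff (cochain_sign a) = - cochain_sign (codiff a).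
Proof.
apply: cochainP => -[|n] s /=; first by rewrite mulr0 oppr0.
rewrite exprS mulN1r mulNr opprK big_distrr; apply: eq_bigr => i _.
by rewrite /= mulrCA.
Qed.

Lemma cochain_sign0 : cochain_sign 0 = 0.
Proof. by apply: cochainP => n s; rewrite /= mulr0. Qed.

Lemma codiff0 : codiff 0 = 0.
Proof. by have := codiffB 0 0; rewrite !subrr. Qed.

Lemma codiff_cup a b : codiff (a * b) = codiff a * b + cochain_sign a * codiff b.
Proof.
apply: eval_word_inj => n s t; rewrite eval_word_codiff (eq_wdiff (eval_word_cup a b s)) wcup_diff//.
rewrite mul0r subr0 eval_wordD !eval_word_cup (eq_wcupl (eval_word_codiff a s)).
by rewrite (eq_wcupr (eval_word_codiff b s)) (eq_wcupl (eval_word_sign a s)).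
Qed.

Lemma codiff1 : codiff 1 = 0.
Proof.
have s1 : cochain_sign 1 = 1.
  by apply: cochainP => -[|n] s /=; rewrite ?mul1r// /cochain1_val mulr0.
apply: (@addrI _ (codiff 1)); rewrite addr0.
by rewrite -[in RHS](mulr1 1) codiff_cup s1 mulr1 mul1r.
Qed.

End Cochains.

Section Cohomology.
Variables (K : realType) (R : comPzRingType) (X : topologicalType).
Local Notation cochain := (cochain K R X).

(* [cocycle] and [is_coboundary] concern all degrees at once: [codiff] raises
   the degree by one, so the quotient is the direct sum of the H^n(X; R). *)
Definition is_cocycle : {pred cochain} := fun a => codiff a == 0.

Lemma cocycle_subring_closed : subring_closed is_cocycle.
Proof.
split=> [|a b /eqP a0 /eqP b0|a b /eqP a0 /eqP b0]; apply/eqP.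
- exact: codiff1.
- by rewrite codiffB a0 b0 subrr.
- by rewrite codiff_cup a0 b0 mulr0 mul0r addr0.
Qed.
HB.instance Definition _ :=
  GRing.isSubringClosed.Build cochain is_cocycle cocycle_subring_closed.

Record cocycle := Cocycle {
  cocycle_val :> cochain;
  cocycle_valP : cocycle_val \in is_cocycle
}.

HB.instance Definition _ := [isSub for cocycle_val].
HB.instance Definition _ := [Choice of cocycle by <:].
HB.instance Definition _ := GRing.SubChoice_isSubPzRing.Build
  cochain is_cocycle cocycle cocycle_subring_closed.

Definition is_coboundary : {pred cocycle} :=
  fun a => `[< exists b : cochain, val a = codiff b >].

Lemma coboundary_zmod_closed : zmod_closed is_coboundary.
Proof.
split; first by apply/asboolP; exists 0; rewrite codiff0.
move=> a b /asboolP[c ac] /asboolP[d bd]; apply/asboolP; exists (c - d).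
by rewrite codiffB -ac -bd.
Qed.
HB.instance Definition _ :=
  GRing.isZmodClosed.Build cocycle is_coboundary coboundary_zmod_closed.

Lemma coboundaryMl (a b : cocycle) : b \in is_coboundary -> a * b \in is_coboundary.
Proof.
case/asboolP=> c bc; apply/asboolP; exists (cochain_sign (val a) * c).
have /eqP a0 := valP a.
by rewrite codiff_cup codiff_sign a0 cochain_sign0 oppr0 mul0r add0r cochain_signK rmorphM /= -bc.
Qed.

Lemma coboundaryMr (a b : cocycle) : a \in is_coboundary -> a * b \in is_coboundary.
Proof.
case/asboolP=> c ac; apply/asboolP; exists (c * val b).
have /eqP b0 := valP b.
by rewrite codiff_cup b0 mulr0 addr0 rmorphM /= -ac.
Qed.

Definition cohomology := @Quotient.quot cocycle is_coboundary.
HB.instance Definition _ := ZmodQuotient.on cohomology.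

Lemma cohomology_eq (a b : cocycle) :
  (\pi_cohomology a == \pi_cohomology b) = (a - b \in is_coboundary).
Proof. by rewrite [RHS]Quotient.idealrBE. Qed.

Definition cohomology1 : cohomology := lift_cst cohomology 1.
Definition cohomologyM := lift_op2 cohomology *%R.

Lemma pi_cohomologyB : {morph \pi_cohomology : a b / a - b}.
Proof. by move=> a b; rewrite !piE. Qed.

Lemma pi_cohomologyM : {morph \pi_cohomology : a b / a * b >-> cohomologyM a b}.
Proof.
move=> a b; unlock cohomologyM; apply/eqP; rewrite cohomology_eq.
rewrite -[a * b](subrK (a * repr (\pi_cohomology b))).
rewrite -addrA -mulrBr -mulrBl rpredD//; [apply: coboundaryMl|apply: coboundaryMr].
all: by rewrite -cohomology_eq reprK.
Qed.
Canonical pi_cohomologyM_morph := PiMorph2 pi_cohomologyM.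

Lemma pi_cohomology1 : \pi_cohomology 1 = cohomology1.
Proof. by rewrite /cohomology1; unlock. Qed.
Canonical pi_cohomology1_morph := PiMorph pi_cohomology1.

Lemma cohomologyMA : associative cohomologyM.
Proof. by elim/quotW=> a; elim/quotW=> b; elim/quotW=> c; rewrite !piE mulrA. Qed.
Lemma cohomology1M : left_id cohomology1 cohomologyM.
Proof. by elim/quotW=> a; rewrite !piE mul1r. Qed.
Lemma cohomologyM1 : right_id cohomology1 cohomologyM.
Proof. by elim/quotW=> a; rewrite !piE mulr1. Qed.
Lemma cohomologyMDl : left_distributive cohomologyM +%R.
Proof. by elim/quotW=> a; elim/quotW=> b; elim/quotW=> c; rewrite !piE mulrDl. Qed.
Lemma cohomologyMDr : right_distributive cohomologyM +%R.
Proof. by elim/quotW=> a; elim/quotW=> b; elim/quotW=> c; rewrite !piE mulrDr. Qed.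

HB.instance Definition _ := GRing.Zmodule_isPzRing.Build cohomology
  cohomologyMA cohomology1M cohomologyM1 cohomologyMDl cohomologyMDr.

End Cohomology.

Section Induced.
Variables (K : realType) (R : comPzRingType).

Section Map.
Variables (X Y : topologicalType) (f : continuousType X Y).

Lemma cochain_map_bounded (a : cochain K R Y) : exists N,
  forall n (sigma : singular_simplex K X n), (N <= n)%N -> a n (f \o sigma) = 0.
Proof. by have [N aN] := cochain_bounded a; exists N => n s; exact: aN. Qed.
Definition cochain_map (a : cochain K R Y) : cochain K R X :=
  Cochain (cochain_map_bounded a).

Lemma cochain_map_diff a : cochain_map (codiff a) = codiff (cochain_map a).
Proof.
apply: cochainP => -[//|n] s; apply: eq_bigr => i _ /=; congr (_ * a n _).
exact/continuousEP.
Qed.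

Lemma cochain_map_cup a b :
  cochain_map (a * b) = cochain_map a * cochain_map b.
Proof.
apply: cochainP => n s; apply: eq_bigr => p _ /=.
by congr (a p _ * b (n - p)%N _); exact/continuousEP.
Qed.

Lemma cochain_map_is_cocycle (a : cocycle K R Y) :
  cochain_map (val a) \in @is_cocycle K R X.
Proof.
have /eqP a0 := valP a; apply/eqP; rewrite -cochain_map_diff a0.
exact: cochainP.
Qed.
Definition cocycle_map (a : cocycle K R Y) : cocycle K R X :=
  Cocycle (cochain_map_is_cocycle a).

Lemma cocycle_mapB : {morph cocycle_map : a b / a - b}.
Proof. by move=> a b; apply/val_inj/cochainP => n s. Qed.

Lemma cocycle_mapM : {morph cocycle_map : a b / a * b}.
Proof.
by move=> a b; apply: val_inj; rewrite /= cochain_map_cup.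
Qed.

Lemma cocycle_map1 : cocycle_map 1 = 1.
Proof. by apply/val_inj/cochainP => n s. Qed.

Definition cohomology_map (c : cohomology K R Y) : cohomology K R X :=
  \pi_(cohomology K R X) (cocycle_map (repr c)).

Lemma cohomology_map_pi (a : cocycle K R Y) :
  cohomology_map (\pi_(cohomology K R Y) a) =
  \pi_(cohomology K R X) (cocycle_map a).
Proof.
apply/eqP; rewrite cohomology_eq -cocycle_mapB.
have : repr (\pi_(cohomology K R Y) a) - a \in @is_coboundary K R Y.
  by rewrite -cohomology_eq reprK.
case/asboolP=> b ab; apply/asboolP; exists (cochain_map b).
by rewrite -cochain_map_diff -ab.
Qed.

Lemma cohomology_map_zmod_morphism : zmod_morphism cohomology_map.
Proof.
elim/quotW=> a; elim/quotW=> b.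
by rewrite -pi_cohomologyB !cohomology_map_pi cocycle_mapB pi_cohomologyB.
Qed.

Lemma cohomology_map_monoid_morphism : monoid_morphism cohomology_map.
Proof.
split; first by rewrite -[1]pi_cohomology1 cohomology_map_pi cocycle_map1 piE.
elim/quotW=> a; elim/quotW=> b.
rewrite -[X in cohomology_map X = _]pi_cohomologyM.
by rewrite !cohomology_map_pi cocycle_mapM -[RHS]pi_cohomologyM.
Qed.

HB.instance Definition _ := GRing.isZmodMorphism.Build
  (cohomology K R Y) (cohomology K R X) cohomology_map
  cohomology_map_zmod_morphism.
HB.instance Definition _ := GRing.isMonoidMorphism.Build
  (cohomology K R Y) (cohomology K R X) cohomology_map
  cohomology_map_monoid_morphism.

End Map.
End Induced.

Inductive natinf := Fin of nat | Inf.

Definition natinf_code (x : natinf) : option nat :=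
  if x is Fin n then Some n else None.
Definition natinf_decode (x : option nat) : natinf :=
  if x is Some n then Fin n else Inf.
Lemma natinf_codeK : cancel natinf_code natinf_decode. Proof. by case. Qed.
HB.instance Definition _ := Countable.copy natinf (can_type natinf_codeK).

Definition natinf_le (x y : natinf) : bool :=
  match x, y with
  | _, Inf => true
  | Inf, Fin _ => false
  | Fin m, Fin n => (m <= n)%N
  end.
Definition natinf_lt (x y : natinf) : bool := (y != x) && natinf_le x y.
Definition natinf_min (x y : natinf) := if natinf_lt x y then x else y.
Definition natinf_max (x y : natinf) := if natinf_lt x y then y else x.

Lemma natinf_le_anti : antisymmetric natinf_le.
Proof. by move=> [m|] [n|] //= /anti_leq ->. Qed.
Lemma natinf_le_trans : transitive natinf_le.
Proof. by move=> [m|] [n|] [p|] //=; exact: leq_trans. Qed.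
Lemma natinf_le_total : total natinf_le.
Proof. by move=> [m|] [n|] //=; exact: leq_total. Qed.

Fact natinf_display : Order.disp_t. Proof. exact: Order.Disp tt tt. Qed.
HB.instance Definition _ := @Order.isOrder.Build natinf_display natinf
  natinf_le natinf_lt natinf_min natinf_max
  (fun _ _ => erefl) (fun _ _ => erefl) (fun _ _ => erefl)
  natinf_le_anti natinf_le_trans natinf_le_total.

Definition least (P : nat -> Prop) : natinf :=
  match pselect (exists n, `[< P n >]) with
  | left exP => Fin (ex_minn exP)
  | right _ => Inf
  end.

(* [Inf] also when no natural number satisfies [P] *)
Definition greatest (P : nat -> Prop) : natinf :=
  match pselect (exists n, P n /\ forall m, P m -> (m <= n)%N) with
  | left exP => Fin (projT1 (cid exP))
  | right _ => Inf
  end.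

(* The first case matters only when the ring [A] is trivial: otherwise the
   empty product 1 is non-zero. *)
Definition nil_index (A : pzRingType) (S : set A) : natinf :=
  if pselect (forall x, S x -> x = 0) then Fin 0
  else greatest (fun k => exists x : 'I_k -> A,
         (forall i, S (x i)) /\ \prod_(i < k) x i != 0).

HB.mixin Record isTopologicalGroup G of Group G & Topological G := {
  mulg_continuous : continuous (fun p : G * G => (p.1 * p.2)%g);
  invg_continuous : continuous (fun g : G => (g^-1)%g)
}.
#[short(type="topologicalGroupType")]
HB.structure Definition TopologicalGroup :=
  {G of Group G & Topological G & isTopologicalGroup G}.

Section TopG.
Variable G : topologicalGroupType.

Record gspace := GSpace {
  gspace_sort :> topologicalType;
  gact : G -> gspace_sort -> gspace_sort;
  gact1 : forall x, gact 1%g x = x;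
  gactM : forall g h x, gact (g * h)%g x = gact g (gact h x);
  gact_continuous : continuous (fun p : G * gspace_sort => gact p.1 p.2)
}.

Record gmap (X Y : gspace) := GMap {
  gmap_val :> continuousType X Y;
  gmap_equivariant : forall g x, gmap_val (gact g x) = gact g (gmap_val x)
}.

Definition gmap_id (X : gspace) : gmap X X :=
  @GMap X X idfun (fun _ _ => erefl).

Lemma gmap_comp_equivariant (X Y Z : gspace) (g : gmap Y Z) (f : gmap X Y) a x :
  (g \o f) (gact a x) = gact a ((g \o f) x).
Proof. by rewrite /= !gmap_equivariant. Qed.
Definition gmap_comp (X Y Z : gspace) (g : gmap Y Z) (f : gmap X Y) : gmap X Z :=
  GMap (gmap_comp_equivariant g f).

Section Product.
Variables X Y : gspace.

Definition prod_act (g : G) (p : X * Y) : X * Y := (gact g p.1, gact g p.2).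
Lemma prod_act1 p : prod_act 1%g p = p.
Proof. by case: p => x y; rewrite /prod_act !gact1. Qed.
Lemma prod_actM g h p : prod_act (g * h)%g p = prod_act g (prod_act h p).
Proof. by rewrite /prod_act !gactM. Qed.
Lemma prod_act_continuous :
  continuous (fun p : G * (X * Y)%type => prod_act p.1 p.2).
Proof.
move=> [g [x y]]; apply: cvg_pair.
  apply: (@cvg_comp _ _ _ (fun p : G * (X * Y)%type => (p.1, p.2.1))
    (fun p : G * X => gact p.1 p.2) _ (nbhs (g, x))).
    apply: cvg_pair; first exact: cvg_fst.
    by apply: (@cvg_comp _ _ _ snd fst _ (nbhs (x, y))); [exact: cvg_snd|exact: cvg_fst].
  exact: (@gact_continuous X (g, x)).
apply: (@cvg_comp _ _ _ (fun p : G * (X * Y)%type => (p.1, p.2.2))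
  (fun p : G * Y => gact p.1 p.2) _ (nbhs (g, y))).
  apply: cvg_pair; first exact: cvg_fst.
  by apply: (@cvg_comp _ _ _ snd snd _ (nbhs (x, y))); [exact: cvg_snd|exact: cvg_snd].
exact: (@gact_continuous Y (g, y)).
Qed.
Definition prod_gspace : gspace :=
  @GSpace (X * Y)%type prod_act prod_act1 prod_actM prod_act_continuous.

End Product.

Section ProductMap.
Variables (X X' Y Y' : gspace) (f : gmap X Y) (f' : gmap X' Y').

Definition prod_map (p : prod_gspace X X') : prod_gspace Y Y' :=
  (f p.1, f' p.2).
Lemma prod_map_continuous : continuous prod_map.
Proof.
move=> [x x']; apply: cvg_pair.
  by apply: (@cvg_comp _ _ _ fst f _ (nbhs x)); [exact: cvg_fst|exact: cts_fun].
by apply: (@cvg_comp _ _ _ snd f' _ (nbhs x')); [exact: cvg_snd|exact: cts_fun].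
Qed.
HB.instance Definition _ := @isContinuous.Build _ _ prod_map prod_map_continuous.
Lemma prod_map_equivariant g p : prod_map (gact g p) = gact g (prod_map p).
Proof. by rewrite /prod_map /= /prod_act !gmap_equivariant. Qed.
Definition gmap_prod : gmap (prod_gspace X X') (prod_gspace Y Y') :=
  GMap prod_map_equivariant.

End ProductMap.

Section Diagonal.
Variable X : gspace.

Definition diag_map (x : X) : prod_gspace X X := (x, x).
Lemma diag_map_continuous : continuous diag_map.
Proof. by move=> x; apply: cvg_pair; exact: cvg_id. Qed.
HB.instance Definition _ :=
  @isContinuous.Build _ _ diag_map diag_map_continuous.
Definition gmap_diag : gmap X (prod_gspace X X) :=
  @GMap X (prod_gspace X X) diag_map (fun _ _ => erefl).

End Diagonal.

Inductive topG_cell := Ob of gspace | Mor X Y of gmap X Y.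

Record categorical_invariant d (V : orderType d) (I : topG_cell -> V) : Prop := {
  invariant_id : forall X : gspace, I (Mor (gmap_id X)) = I (Ob X);
  invariant_comp : forall (X Y Z W : gspace)
      (f : gmap X Y) (g : gmap Y Z) (h : gmap Z W),
    (I (Mor (gmap_comp h (gmap_comp g f))) <= I (Mor g))%O
}.

Section Orbits.
Variable X : gspace.

Definition orbit_rel (x y : X) : bool := `[< exists g, y = gact g x >].
Lemma orbit_rel_equiv : equiv_class_of orbit_rel.
Proof.
split=> [x|x y|y x z].
- by apply/asboolP; exists 1%g; rewrite gact1.
- by apply/asboolP/asboolP => -[g ->]; exists (g^-1)%g;
    rewrite -gactM mulVg gact1.
- move=> /asboolP[g ->] /asboolP[h ->]; apply/asboolP.
  by exists (h * g)%g; rewrite gactM.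
Qed.
Canonical orbit_equiv := EquivRelPack orbit_rel_equiv.

Definition orbit_space : topologicalType :=
  quotient_topology {eq_quot orbit_equiv}.
Definition to_orbit (x : X) : orbit_space := \pi_{eq_quot orbit_equiv} x.

Lemma to_orbit_act g x : to_orbit (gact g x) = to_orbit x.
Proof. by apply/esym/eqmodP/asboolP; exists g. Qed.

End Orbits.

Section OrbitMap.
Variables (X Y : gspace) (f : gmap X Y).

Definition orbit_map (q : orbit_space X) : orbit_space Y :=
  to_orbit (f (repr (q : {eq_quot orbit_equiv X}))).
Lemma orbit_mapE x : orbit_map (to_orbit x) = to_orbit (f x).
Proof.
rewrite /orbit_map; case: piP => y /eqmodP/asboolP[g ->].
by rewrite gmap_equivariant to_orbit_act.
Qed.
Lemma orbit_map_continuous : continuous orbit_map.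
Proof.
apply/quotient_continuous => x.
rewrite (_ : _ \o _ = @to_orbit Y \o f); last first.
  by apply/funext => y; exact: orbit_mapE.
by apply: continuous_comp; [exact: cts_fun|exact: pi_continuous].
Qed.
HB.instance Definition _ :=
  @isContinuous.Build _ _ orbit_map orbit_map_continuous.
End OrbitMap.

End TopG.

Section Paths.
Variable K : realType.

Definition unit_interval : topologicalType := set_type (`[0, 1]%classic : set K).

Lemma zero_in_itv : (0 : K) \in `[0, 1]%classic.
Proof. by rewrite inE /= in_itv /= lexx ler01. Qed.
Lemma one_in_itv : (1 : K) \in `[0, 1]%classic.
Proof. by rewrite inE /= in_itv /= lexx ler01. Qed.
Definition path0 : unit_interval := exist _ 0 zero_in_itv.
Definition path1 : unit_interval := exist _ 1 one_in_itv.

Definition path_space (Y : topologicalType) := continuousType unit_interval Y.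
HB.instance Definition _ (Y : topologicalType) := Choice.on (path_space Y).
HB.instance Definition _ (Y : topologicalType) :=
  Topological.copy (path_space Y)
    (@initial_topology (path_space Y) {compact-open, unit_interval -> Y}
      (fun gamma => gamma : unit_interval -> Y)).

Definition path_ends (Y : topologicalType) (gamma : path_space Y) : Y * Y :=
  (gamma path0, gamma path1).

Definition contractible (X : topologicalType) : Prop :=
  exists (x0 : X) (H : X * unit_interval -> X),
    [/\ continuous H, forall x, H (x, path0) = x & forall x, H (x, path1) = x0].

End Paths.

Section Invariants.
Variables (K : realType) (G : topologicalGroupType).

Section Act.
Variable Y : gspace G.
Lemma gact_cts (g : G) : continuous (gact g : Y -> Y).
Proof.
move=> y; apply: (@continuous_comp _ _ _ (fun y : Y => (g, y))
  (fun p : G * Y => gact p.1 p.2)); last exact: gact_continuous.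
by apply: cvg_pair; [exact: cvg_cst|exact: cvg_id].
Qed.
HB.instance Definition _ g := @isContinuous.Build Y Y (gact g) (@gact_cts g).

Definition path_act (g : G) (gamma : path_space K Y) : path_space K Y :=
  gact g \o gamma.
End Act.

Definition invariant_set (X : gspace G) (U : set X) : Prop :=
  forall g x, U x -> U (gact g x).

(* [s] stands for its restriction to the invariant set [U]; the values of [s]
   outside [U] are irrelevant. *)
Definition local_gmap_to_paths (X Y : gspace G) (U : set X)
    (s : X -> path_space K Y) : Prop :=
  {within U, continuous s} /\
  forall g x, U x -> s (gact g x) = path_act g (s x).

Definition invariant_open_cover (X : gspace G) n (U : 'I_n.+1 -> set X) : Prop :=
  (forall i, open (U i) /\ invariant_set (U i)) /\ \bigcup_i U i = [set: X].

Definition TC_gmap (X Y : gspace G) (f : gmap X Y) : natinf :=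
  least (fun n => exists U : 'I_n.+1 -> set (prod_gspace X X),
    invariant_open_cover U /\
    forall i, exists s : prod_gspace X X -> path_space K Y,
      local_gmap_to_paths (U i) s /\
      forall x0 x1, U i (x0, x1) ->
        s (x0, x1) (path0 K) = f x0 /\ s (x0, x1) (path1 K) = f x1).

Definition TC_gspace (X : gspace G) : natinf :=
  least (fun n => exists U : 'I_n.+1 -> set (prod_gspace X X),
    invariant_open_cover U /\
    forall i, exists s : prod_gspace X X -> path_space K X,
      local_gmap_to_paths (U i) s /\
      forall x, U i x -> path_ends (s x) = x).

Definition TC (x : topG_cell G) : natinf :=
  match x with Ob X => TC_gspace X | Mor X Y f => TC_gmap f end.

(* A G-homeomorphism from G x U onto the part of E over U, compatible with the
   projections to U: [phi], whose inverse is [e |-> (theta e, to_orbit e)].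
   G acts on G x U by left translation of the first factor. *)
Definition trivial_over (E : gspace G) (U : set (orbit_space E)) : Prop :=
  exists (phi : G * orbit_space E -> E) (theta : E -> G),
  [/\ {within [set p | U p.2], continuous phi},
      {within [set e | U (to_orbit e)], continuous theta},
      forall g h b, U b -> phi ((g * h)%g, b) = gact g (phi (h, b)),
      forall g b, U b -> to_orbit (phi (g, b)) = b /\ theta (phi (g, b)) = g &
      forall e, U (to_orbit e) -> phi (theta e, to_orbit e) = e].

(* The projection from E to E/G is a numerable principal G-bundle: E is locally
   trivial over the cozero sets of a locally finite partition of unity. *)
Definition numerable_principal (E : gspace G) : Prop :=
  exists (J : choiceType) (u : J -> orbit_space E -> K),
  [/\ forall j, continuous (u j),
      forall j b, 0 <= u j b,
      forall b : orbit_space E, exists2 N, nbhs b N &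
        finite_set [set j | exists2 b', N b' & u j b' != 0],
      forall b, \sum_(j \in [set: J]) u j b = 1 &
      forall j, trivial_over [set b | 0 < u j b]].

(* Dold: a numerable principal G-bundle is universal if and only if its total
   space is contractible. *)
Definition universal_gspace (E : gspace G) : Prop :=
  numerable_principal E /\ contractible K E.

Variables (R : comPzRingType) (EG : gspace G).

(* EG carries a left action, so that EG x_G X is the orbit space of the diagonal
   action; a right action is made into a left one by inverting group elements. *)
Definition homotopy_orbits (X : gspace G) : topologicalType :=
  orbit_space (prod_gspace EG X).
Definition homotopy_orbits_map (X Y : gspace G) (f : gmap X Y) :
    continuousType (homotopy_orbits X) (homotopy_orbits Y) :=
  orbit_map (gmap_prod (gmap_id EG) f).

Definition borel_cohomology (X : gspace G) : pzRingType :=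
  cohomology K R (homotopy_orbits X).
Definition borel_map (X Y : gspace G) (f : gmap X Y) :
    {rmorphism borel_cohomology Y -> borel_cohomology X} :=
  cohomology_map (homotopy_orbits_map f).

Definition zero_divisors (X : gspace G) :
    set (borel_cohomology (prod_gspace X X)) :=
  [set c | borel_map (gmap_diag X) c = 0].
Arguments zero_divisors : clear implicits.

Definition zcl (x : topG_cell G) : natinf :=
  match x with
  | Ob X => nil_index (zero_divisors X)
  | Mor X Y f =>
      nil_index (borel_map (gmap_prod f f) @` zero_divisors Y)
  end.

End Invariants.

Arguments TC K {G}.
Arguments zero_divisors K {G} R EG X.
Arguments zcl K {G} R EG.

(* Main.v *)
Require Import Defs.
From mathcomp Require Import all_boot all_order all_algebra.
From mathcomp Require Import all_classical all_reals topology normedtype.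

(* Both invariants are monotone by naturality. Since (h x h) o Delta = Delta o h,
   the map (h x h)^* carries zero-divisors of W to zero-divisors of Z, and a
   ring morphism cannot turn a vanishing product into a non-vanishing one.
   For TC, an open cover of Y x Y with local G-maps s_i : U_i -> Z^I
   for g is pulled back along f x f, and s_i is replaced by h o s_i o (f x f). *)

Set Implicit Arguments.
Unset Strict Implicit.
Unset Printing Implicit Defensive.

Import GRing.Theory.

Local Open Scope classical_set_scope.
Local Open Scope ring_scope.
Local Open Scope quotient_scope.

Section Functoriality.
Variables (K : realType) (R : comPzRingType).

(** Functoriality is stated up to pointwise equality because [orbit_map] passes through a chosen
    representative, so on orbit spaces the identity and composition laws are not definitional. *)
Lemma cohomology_map_id (X : topologicalType) (f : continuousType X X) :
  f =1 id -> @cohomology_map K R X X f =1 id.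
Proof.
move=> fE; elim/quotW => a; rewrite cohomology_map_pi; congr (\pi _).
apply/val_inj/cochainP => n s /=.
have -> // : (f \o s : continuousType _ _) = s.
  by apply/continuousEP => t /=; rewrite fE.
Qed.

Lemma cohomology_map_comp (X Y Z : topologicalType) (f : continuousType X Y)
    (g : continuousType Y Z) (h : continuousType X Z) : h =1 g \o f ->
  @cohomology_map K R X Z h =1 cohomology_map f \o cohomology_map g.
Proof.
move=> hE; elim/quotW => a; rewrite /comp [cohomology_map g _]cohomology_map_pi !cohomology_map_pi; congr (\pi _).
apply/val_inj/cochainP => n s /=.
have -> // : (h \o s : continuousType _ _) = g \o (f \o s).
  by apply/continuousEP => t /=; rewrite hE.
Qed.

Variables (G : topologicalGroupType) (EG : gspace G).

Lemma borel_map_id (X : gspace G) (f : gmap X X) :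
  f =1 id -> borel_map K R EG f =1 id.
Proof.
move=> fE; apply: cohomology_map_id; elim/quotW => p.
rewrite [LHS]orbit_mapE; congr (to_orbit _).
by case: p => e x; rewrite /= /prod_map /= fE.
Qed.

Lemma borel_map_comp (X Y Z : gspace G) (f : gmap X Y) (g : gmap Y Z)
    (h : gmap X Z) : h =1 g \o f ->
  borel_map K R EG h =1 borel_map K R EG f \o borel_map K R EG g.
Proof.
move=> hE; apply: cohomology_map_comp; elim/quotW => p.
rewrite [LHS]orbit_mapE /comp [homotopy_orbits_map _ f _]orbit_mapE.
rewrite [RHS]orbit_mapE; congr (to_orbit _).
by rewrite /= /prod_map /= hE.
Qed.

Lemma borel_map_zero_divisors (X Y : gspace G) (f : gmap X Y) c :
  zero_divisors K R EG Y c ->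
  zero_divisors K R EG X (borel_map K R EG (gmap_prod f f) c).
Proof.
rewrite /zero_divisors /= => c0.
(* One composite X -> Y x Y is factored in two ways: through X x X, and through the diagonal of Y,
   whose induced map kills [c]. *)
have := @borel_map_comp _ _ _ (gmap_diag X) (gmap_prod f f)
  (gmap_comp (gmap_prod f f) (gmap_diag X)) (fun=> erefl) c.
have := @borel_map_comp _ _ _ f (gmap_diag Y)
  (gmap_comp (gmap_prod f f) (gmap_diag X)) (fun=> erefl) c.
by rewrite /= c0 raddf0 => -> <-.
Qed.

End Functoriality.

(** A maximum of [Q] bounds [P], which then has a maximum because it is inhabited; for an empty [P],
    [greatest P] would be [Inf]. *)
Lemma le_greatest (P Q : nat -> Prop) :
  (exists n, P n) -> (forall n, P n -> Q n) -> (greatest P <= greatest Q)%O.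
Proof.
move=> [n0 Pn0] PQ; rewrite /greatest.
case: pselect => [exP|nP]; case: pselect => [exQ|nQ] //=.
  have [Pn _] := projT2 (cid exP); have [_ leQ] := projT2 (cid exQ).
  by apply: leQ; apply: PQ.
exfalso; apply: nP; have [n [_ leQ]] := exQ.
have exP : exists m, `[< P m >] by exists n0; apply/asboolP.
have ubP m : `[< P m >] -> (m <= n)%N by move=> /asboolP/PQ/leQ.
case: (ex_maxnP exP ubP) => m /asboolP Pm lem.
by exists m; split => // k Pk; apply: lem; apply/asboolP.
Qed.

Lemma le_least (P Q : nat -> Prop) :
  (forall n, Q n -> P n) -> (least P <= least Q)%O.
Proof.
move=> QP; rewrite /least.
case: pselect => [exP|nP]; case: pselect => [exQ|nQ] //=.
  case: ex_minnP => m _ lem; case: ex_minnP => n /asboolP Qn _.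
  by apply: lem; apply/asboolP/QP.
by case: nP; have [n /asboolP/QP Pn] := exQ; exists n; apply/asboolP.
Qed.

(** A non-zero product in [T] lifts factor by factor to a product in [S], which is non-zero since
    its image under [phi] is. *)
Lemma le_nil_index (A B : pzRingType) (phi : {rmorphism A -> B})
    (S : set A) (T : set B) :
  (forall y, T y -> exists2 x, S x & phi x = y) ->
  (nil_index T <= nil_index S)%O.
Proof.
move=> ST; rewrite /nil_index.
case: (pselect (forall y, T y -> y = 0)) => [T0|nT0] /=.
  (* [Fin 0] is the bottom element, so the right-hand side can be generalised. *)
  by move: (X in (_ <= X)%O) => -[].
case: (pselect (forall x, S x -> x = 0)) => [S0|_] /=.
  by case: nT0 => y /ST[x /S0 -> <-]; rewrite raddf0.
apply: le_greatest.
  (* A non-zero element of [T] is a product of length 1, the witness that [le_greatest] asks for. *)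
  have [y nTy] := (existsNP _).2 nT0; have [Ty /eqP y0] := (not_implyP _ _).1 nTy.
  by exists 1%N, (fun=> y); rewrite big_ord1.
move=> k [y [Ty y0]].
have /choice[x xP] : forall i, exists x, S x /\ phi x = y i.
  by move=> i; have [x Sx xy] := ST _ (Ty i); exists x.
exists x; split => [i|]; first by have [] := xP i.
apply: contra_neq y0 => x0.
have -> : \prod_(i < k) y i = phi (\prod_(i < k) x i).
  by rewrite rmorph_prod; apply: eq_bigr => i _; have [_ ->] := xP i.
by rewrite x0 raddf0.
Qed.

Lemma zcl_categorical (K : realType) (G : topologicalGroupType)
    (R : comPzRingType) (EG : gspace G) : categorical_invariant (zcl K R EG).
Proof.
split=> [X|X Y Z W f g h] /=.
  congr nil_index; have idE : forall c, borel_map K R EG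
      (gmap_prod (gmap_id X) (gmap_id X)) c = c.
    by apply: borel_map_id => -[x y].
  apply/seteqP; split=> [_ [c c0 <-]|c c0]; first by rewrite idE.
  by exists c => //; exact: idE.
(* The set for h o g o f lies in the image under (f x f)^* of the set for g, as (h x h)^* c is again
   a zero-divisor. *)
apply: (@le_nil_index _ _ (borel_map K R EG (gmap_prod f f))) => _ [c c0 <-].
exists (borel_map K R EG (gmap_prod g g) (borel_map K R EG (gmap_prod h h) c)).
  by exists (borel_map K R EG (gmap_prod h h) c) => //;
    exact: borel_map_zero_divisors.
pose k := gmap_comp g f.
rewrite (@borel_map_comp _ _ _ _ _ _ _ (gmap_prod k k) (gmap_prod h h))//=.
by rewrite (@borel_map_comp _ _ _ _ _ _ _ (gmap_prod f f) (gmap_prod g g)).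
Qed.

Section PathPostcomposition.
Variables (K : realType) (G : topologicalGroupType).

(** Subbasic sets pull back to subbasic sets: h o gamma maps the compact set A into O exactly when
    gamma maps A into the preimage of O under h. *)
Lemma path_postcomp_continuous (X Y : topologicalType) (h : continuousType X Y) :
  continuous (fun gamma : path_space K X => h \o gamma : path_space K Y).
Proof.
apply: continuous_comp_initial => gamma.
apply/compact_open_cvgP => [|A O cA oO hO].
  exact: (@fmap_filter _ _ _ (nbhs gamma)).
have oO' : open (h @^-1` O) by apply: open_comp => // x _; exact: cts_fun.
have oB := @compact_open_open _ X A _ cA oO'.
have := @initial_continuous (path_space K X) {compact-open, unit_interval K -> X}
  (fun gamma => gamma : unit_interval K -> X) gamma.
move=> /(_ [set g | g @` A `<=` h @^-1` O]) /=.
rewrite nbhs_simpl /= => B; apply: filterS (B _).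
  by move=> d dO _ [t At <-]; apply: dO; exists t.
apply: open_nbhs_nbhs; split => // _ [t At <-]; apply: hO.
by exists t.
Qed.

Lemma TC_gmap_comp (X Y Z W : gspace G)
    (f : gmap X Y) (g : gmap Y Z) (h : gmap Z W) :
  (TC_gmap K (gmap_comp h (gmap_comp g f)) <= TC_gmap K g)%O.
Proof.
apply: le_least => n [U [[Uo Ucov] sU]].
pose F := gmap_prod f f.
have Fc : continuous F by exact: cts_fun.
exists (fun i => F @^-1` U i); split.
  split=> [i|].
    have [oU iU] := Uo i; split; first by apply: open_comp => // x _; exact: Fc.
    by move=> a x Ux; rewrite /preimage /mkset gmap_equivariant; exact: iU.
  apply/seteqP; split=> // x _; have : [set: prod_gspace Y Y] (F x) by [].
  by rewrite -Ucov => -[i _ Ui]; exists i.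
move=> i; have [s [[sc se] sP]] := sU i.
exists (fun x => h \o s (F x)); split; last first.
  by move=> x0 x1 /= Ux; have [-> ->] := sP _ _ Ux.
split.
  apply/subspace_continuousP => x Ux.
  apply: (@cvg_comp _ _ _ (fun x => s (F x))
    (fun gamma : path_space K Z => h \o gamma : path_space K W) _ (nbhs (s (F x))));
    last exact: path_postcomp_continuous.
  (* [s] is continuous only within [U i], so the intermediate filter must be restricted to [U i]. *)
  apply: (@cvg_comp _ _ _ F s _ (within (U i) (nbhs (F x)))); last first.
    by move/subspace_continuousP: sc; apply.
  move=> B /Fc; rewrite /within /= !nbhs_simpl /=.
  by apply: filterS => y; apply.
move=> a x Ux; rewrite gmap_equivariant se//; apply/continuousEP => t /=.
by rewrite gmap_equivariant.
Qed.

Lemma TC_categorical : categorical_invariant (TC K (G := G)).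
Proof.
split=> [X|X Y Z W f g h] /=; last exact: TC_gmap_comp.
(* For the identity map the two endpoint equations amount to [path_ends (s x) = x], so both sides
   minimise equivalent predicates. *)
congr least; apply/funext => n; apply/propext.
split=> -[U [Ucov sU]]; exists U; split=> // i; have [s [ls sP]] := sU i;
    exists s; split=> // x.
  by case: x => x0 x1 /sP[e0 e1]; rewrite /path_ends e0 e1.
by move=> x1 /sP[-> ->].
Qed.

End PathPostcomposition.

Theorem proposition4p5 (K : realType) (G : topologicalGroupType)
    (R : comPzRingType) :
  (forall EG : gspace G, universal_gspace K EG ->
     categorical_invariant (zcl K R EG)) /\
  categorical_invariant (TC K (G := G)).
Proof. by split=> [EG _|]; [exact: zcl_categorical|exact: TC_categorical]. Qed.
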